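(* For $s=(s_1,s_2)\in(-1,1)\times(0,\infty)$ let $$\rho_1(s)=\frac{1-s_1}{2+s_2},\qquad \rho_2(s)=\frac{1+s_1}{2+s_2},$$ $$G(s)=\left(1+\frac{s_2}2\right)\left[\rho_1(s)\rho_2(s)-(\rho_1(s)+\rho_2(s))V(\rho(s))\right],\qquad \hat\sigma(s)=\left(1+\frac{s_2}2\right)\sigma(\rho(s)),$$ where $\rho(s)=(\rho_1(s),\rho_2(s))$ and $V,\sigma$ are as in the context. Then, with $\hat\sigma_{i,j}=\partial^2\hat\sigma/\partial s_i\partial s_j$, for every $s\in(-1,1)\times(0,\infty)$, $$\partial_{s_1}G(s)=\frac{\hat\sigma_{1,2}(s)}{\hat\sigma_{1,1}(s)},\qquad \partial_{s_2}G(s)=\frac12\,\frac{\hat\sigma_{2,2}(s)}{\hat\sigma_{1,1}(s)} .$$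
   Context: For $\rho=(\rho_1,\rho_2)$ in the open triangle $\mathbb T\subset\mathbb R^2$ with vertices $(0,0),(1,0),(0,1)$, $$V(\rho)=\frac1\pi\frac{\sin(\pi\rho_1)\sin(\pi\rho_2)}{\sin(\pi(1-\rho_1-\rho_2))},$$ $$\sigma(\rho)=\frac1\pi\left[\Lambda(\pi\rho_1)+\Lambda(\pi\rho_2)+\Lambda(\pi(1-\rho_1-\rho_2))\right],\qquad \Lambda(\theta)=\int_0^\theta\ln(2\sin t)\,dt .$$ The map $s\mapsto\rho(s)$ is a bijection from $(-1,1)\times(0,\infty)$ onto $\mathbb T$. *)

(* Defs.v *)
From Stdlib Require Export Reals.
From Coquelicot Require Export Coquelicot.
Open Scope R_scope.

(* [ln (2 * sin t)] is unbounded as [t] decreases to 0, so the integral is the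
   improper one at its lower bound; it converges for [0 < theta < PI]. *)
Definition Lambda (theta : R) : R :=
  RInt_gen (fun t => ln (2 * sin t)) (at_right 0) (at_point theta).

Definition V (r1 r2 : R) : R :=
  / PI * (sin (PI * r1) * sin (PI * r2) / sin (PI * (1 - r1 - r2))).

Definition sigma (r1 r2 : R) : R :=
  / PI * (Lambda (PI * r1) + Lambda (PI * r2) + Lambda (PI * (1 - r1 - r2))).

Definition rho1 (s1 s2 : R) : R := (1 - s1) / (2 + s2).

Definition rho2 (s1 s2 : R) : R := (1 + s1) / (2 + s2).

Definition G (s1 s2 : R) : R :=
  let r1 := rho1 s1 s2 in
  let r2 := rho2 s1 s2 in
  (1 + s2 / 2) * (r1 * r2 - (r1 + r2) * V r1 r2).

Definition sigma_hat (s1 s2 : R) : R :=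
  (1 + s2 / 2) * sigma (rho1 s1 s2) (rho2 s1 s2).

(* [Derive] and [partial_derive] return a value even where the derivative does
   not exist; this predicate says that the partial derivatives of [f] of order
   at most two (mixed ones in both orders) are genuine at [(x, y)]. *)
Definition has_second_partials (f : R -> R -> R) (x y : R) : Prop :=
  ex_derive (fun u => f u y) x /\
  ex_derive (fun v => f x v) y /\
  ex_derive (fun u => partial_derive 1 0 f u y) x /\
  ex_derive (fun v => partial_derive 1 0 f x v) y /\
  ex_derive (fun u => partial_derive 0 1 f u y) x /\
  ex_derive (fun v => partial_derive 0 1 f x v) y.

(* Main.v *)
Require Import Defs.
From Stdlib Require Import Reals Lra.
From Coquelicot Require Import Coquelicot.
Open Scope R_scope.

(** [ln (2 sin t) = ln t + ln (2 sin t / t)], and the second summand extends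
    continuously to [t = 0]; integrating the two summands separately yields an
    antiderivative of [ln (2 sin t)] that vanishes at [0], so that
    [Lambda' = ln (2 sin)] on [(0, PI)].  Write [m = 2 + s2] and
    [(a, b, c) = (PI rho1, PI rho2, PI (1 - rho1 - rho2))].  In the first
    derivatives of [sigma_hat] the logarithms enter only through
    [(ln (2 sin b) - ln (2 sin a)) / 2] and
    [(sigma - rho1 ln (sin a / sin c) - rho2 ln (sin b / sin c)) / 2], so the
    second derivatives are combinations of cotangents, and
    [cot a + cot b = sin (a + b) / (sin a sin b) = 1 / (PI V)] gives
    [sigma_hat_11 = 1 / (2 m V)].  Since [G = (1 - s1^2) / (2 m) - V], both
    claimed identities reduce to [PI V (cot a + cot b) = 1]. *)

(** * The continuous extension of [sin t / t], and the limit of [x * ln x] at 0 *)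

Definition sinc (t : R) : R := if Req_EM_T t 0 then 1 else sin t / t.

Lemma sinc_neq0 (t : R) : t <> 0 -> sinc t = sin t / t.
Proof. intros H; unfold sinc; destruct (Req_EM_T t 0); [contradiction|easy]. Qed.

Lemma sinc_pos (t : R) : - PI < t < PI -> 0 < sinc t.
Proof.
  intros Ht; unfold sinc; destruct (Req_EM_T t 0) as [|n]; [lra|].
  destruct (Rlt_or_le 0 t).
  - apply Rdiv_lt_0_compat; [apply sin_gt_0|]; lra.
  - replace (sin t / t) with (sin (- t) / (- t)) by (rewrite sin_neg; now field).
    apply Rdiv_lt_0_compat; [apply sin_gt_0|]; lra.
Qed.

Lemma continuous_sinc (t : R) : continuous sinc t.
Proof.
  destruct (Req_dec t 0) as [->|n].
  - apply continuity_pt_filterlim, continuity_pt_filterlim'.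
    replace (sinc 0) with 1 by (unfold sinc; destruct (Req_EM_T 0 0); lra).
    assert (L := is_lim_sinc_0).
    apply (is_lim_ext_loc _ sinc) in L; [exact L|].
    (* Any radius would do: the two functions agree everywhere except at 0, which the limit
       ignores. *)
    exists (mkposreal 1 Rlt_0_1); intros y _ Hy; now rewrite sinc_neq0.
  - apply (continuous_ext_loc _ (fun t => sin t / t)).
    + assert (H : open (fun y => y <> 0)) by apply open_neq.
      generalize (H t n); apply filter_imp; intros y Hy; now rewrite sinc_neq0.
    + apply (ex_derive_continuous (fun t => sin t / t)); auto_derive; trivial.
Qed.

(** The substitution [y = / x] reduces this to [ln y / y -> 0] at infinity, up to sign. *)
Lemma filterlim_mult_ln_0 :
  filterlim (fun x => x * ln x) (at_right 0) (locally 0).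
Proof.
  assert (L := filterlim_comp _ _ _ _ _ _ _ _ filterlim_Rinv_0_right is_lim_div_ln_p).
  apply (filterlim_comp _ _ _ _ Ropp) with (2 := filterlim_opp 0) in L.
  change (opp 0) with (- 0) in L; rewrite Ropp_0 in L.
  eapply filterlim_within_ext; [|exact L].
  intros x Hx; simpl; rewrite ln_Rinv by easy; field; lra.
Qed.

(** * An antiderivative of [ln (2 * sin t)] and the derivative of [Lambda] *)

Definition ln_sin_primitive (t : R) : R :=
  t * ln t - t + RInt (fun u => ln (2 * sinc u)) 0 t.

Lemma continuous_ln_sinc (t : R) :
  - PI < t < PI -> continuous (fun u => ln (2 * sinc u)) t.
Proof.
  intros Ht; assert (P := sinc_pos t Ht).
  apply (continuous_comp (fun u => 2 * sinc u) ln).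
  - apply (continuous_mult (fun _ => 2) sinc);
      [apply continuous_const|apply continuous_sinc].
  - apply continuous_ln; lra.
Qed.

(** The range includes [t = 0], so that the integral is also known to be continuous at its lower
    bound. *)
Lemma is_derive_RInt_ln_sinc (t : R) :
  - PI < t < PI ->
  is_derive (RInt (fun u => ln (2 * sinc u)) 0) t (ln (2 * sinc t)).
Proof.
  intros Ht.
  apply (is_derive_RInt (fun u => ln (2 * sinc u)) _ 0);
    [|now apply continuous_ln_sinc].
  apply (locally_interval _ t (- PI) PI); [easy|easy|].
  intros y H1 H2; simpl in H1, H2; apply (RInt_correct (V := R_CompleteNormedModule)).
  apply (ex_RInt_continuous (V := R_CompleteNormedModule)).
  intros z Hz; apply continuous_ln_sinc.
  generalize PI_RGT_0; revert Hz; unfold Rmin, Rmax; destruct (Rle_dec 0 y); lra.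
Qed.

Lemma is_derive_ln_sin_primitive (t : R) :
  0 < t < PI -> is_derive ln_sin_primitive t (ln (2 * sin t)).
Proof.
  intros Ht.
  replace (ln (2 * sin t)) with (ln t + ln (2 * sinc t)).
  - apply (is_derive_plus (fun t => t * ln t - t)).
    + auto_derive; [lra|field; lra].
    + apply is_derive_RInt_ln_sinc; lra.
  - rewrite <- ln_mult; [|lra|].
    + f_equal; rewrite sinc_neq0 by lra; field; lra.
    + assert (P := sinc_pos t); lra.
Qed.

Lemma filterlim_ln_sin_primitive_0 :
  filterlim ln_sin_primitive (at_right 0) (locally 0).
Proof.
  assert (L1 := filterlim_mult_ln_0).
  assert (L2 : filterlim (fun t => - t + RInt (fun u => ln (2 * sinc u)) 0 t)
                 (at_right 0) (locally 0)).
  { apply (filterlim_filter_le_1 (F := locally 0)).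
    - apply filter_le_within.
    (* The limit is written as the value at 0, so that continuity at 0 gives it. *)
    - replace 0 with (- 0 + RInt (fun u => ln (2 * sinc u)) 0 0) at 2
        by (rewrite (RInt_point (V := R_CompleteNormedModule)); unfold zero; simpl; ring).
      apply (continuous_plus Ropp (RInt (fun u => ln (2 * sinc u)) 0)).
      + apply (ex_derive_continuous Ropp); auto_derive; trivial.
      + apply (ex_derive_continuous (RInt (fun u => ln (2 * sinc u)) 0)).
        eexists; apply is_derive_RInt_ln_sinc; generalize PI_RGT_0; lra. }
  assert (L := filterlim_comp_2 _ _ Rplus L1 L2 (filterlim_plus (V := R_NormedModule) 0 0)).
  change (plus 0 0) with (0 + 0) in L; rewrite Rplus_0_r in L.
  eapply filterlim_ext; [|exact L].
  intros x; unfold ln_sin_primitive; simpl; ring.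
Qed.

(** The fundamental theorem of calculus applies on the segment from [x > 0] to [theta]; then [x]
    decreases to 0, where the primitive tends to 0. *)
Lemma Lambda_ln_sin_primitive (theta : R) :
  0 < theta < PI -> Lambda theta = ln_sin_primitive theta.
Proof.
  intros Ht; unfold Lambda.
  apply (is_RInt_gen_unique (V := R_CompleteNormedModule)).
  unfold is_RInt_gen.
  apply (filterlimi_lim_ext_loc
           (fun ab => ln_sin_primitive (snd ab) - ln_sin_primitive (fst ab))).
  - apply (Filter_prod _ _ _ (fun x => 0 < x < PI) (fun y => y = theta)).
    + exists (mkposreal PI PI_RGT_0); intros y By Hy.
      apply Rabs_def2 in By; simpl in By; unfold minus, plus, opp in By; simpl in By; lra.
    + easy.
    + intros x y Hx ->; simpl.
      assert (M : forall z, Rmin x theta <= z <= Rmax x theta -> 0 < z < PI)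
        by (intros z; unfold Rmin, Rmax; destruct (Rle_dec x theta); lra).
      apply (is_RInt_derive ln_sin_primitive (fun t => ln (2 * sin t))).
      * intros z Hz; apply is_derive_ln_sin_primitive; auto.
      * intros z Hz; apply (ex_derive_continuous (fun t => ln (2 * sin t))).
        auto_derive; specialize (M z Hz); assert (S := sin_gt_0 z); lra.
  - replace (ln_sin_primitive theta) with (ln_sin_primitive theta - 0) by ring.
    apply (filterlim_comp_2 (fun ab : R * R => ln_sin_primitive (snd ab))
             (fun ab : R * R => - ln_sin_primitive (fst ab)) Rplus
             (G := locally (ln_sin_primitive theta)) (H := locally (- 0))).
    + apply (filterlim_comp _ _ _ snd ln_sin_primitive _ (at_point theta)).
      * apply filterlim_snd.
      * intros P HP; exact (locally_singleton _ _ HP).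
    + apply (filterlim_comp _ _ _ fst (fun x => - ln_sin_primitive x) _ (at_right 0)).
      * apply filterlim_fst.
      * eapply filterlim_comp;
          [exact filterlim_ln_sin_primitive_0|exact (filterlim_opp 0)].
    + exact (filterlim_plus (V := R_NormedModule) (ln_sin_primitive theta) (- 0)).
Qed.

Lemma is_derive_Lambda (theta : R) :
  0 < theta < PI -> is_derive Lambda theta (ln (2 * sin theta)).
Proof.
  intros Ht.
  apply (is_derive_ext_loc ln_sin_primitive); [|now apply is_derive_ln_sin_primitive].
  apply (locally_interval _ theta 0 PI); [easy|easy|].
  intros y H1 H2; symmetry; now apply Lambda_ln_sin_primitive.
Qed.

(** * The three angles, of sum [PI] *)

Definition in_strip (s1 s2 : R) : Prop := -1 < s1 < 1 /\ 0 < s2.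

Definition angle1 (s1 s2 : R) : R := PI * rho1 s1 s2.
Definition angle2 (s1 s2 : R) : R := PI * rho2 s1 s2.
Definition angle3 (s1 s2 : R) : R := PI * (1 - rho1 s1 s2 - rho2 s1 s2).

Lemma angle3E (s1 s2 : R) : 0 < s2 -> angle3 s1 s2 = PI * (s2 / (2 + s2)).
Proof. intros; unfold angle3, rho1, rho2; field; lra. Qed.

(** Each angle is [PI * (x / (2 + s2))] with [x] one of [1 - s1], [1 + s1], [s2], three positive
    numbers of sum [2 + s2]. *)
Lemma angle_range (s1 s2 : R) :
  in_strip s1 s2 ->
  0 < angle1 s1 s2 < PI /\ 0 < angle2 s1 s2 < PI /\ 0 < angle3 s1 s2 < PI.
Proof.
  intros [H1 H2].
  assert (K : forall x, 0 < x < 2 + s2 -> 0 < PI * (x / (2 + s2)) < PI).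
  { intros x Hx; assert (P := PI_RGT_0); split.
    - apply Rmult_lt_0_compat, Rdiv_lt_0_compat; lra.
    - rewrite <- (Rmult_1_r PI) at 2; apply Rmult_lt_compat_l; [lra|].
      apply Rlt_div_l; lra. }
  rewrite angle3E by easy; unfold angle1, angle2, rho1, rho2.
  repeat split; apply K; lra.
Qed.

Lemma sin_angle_pos (s1 s2 : R) :
  in_strip s1 s2 ->
  0 < sin (angle1 s1 s2) /\ 0 < sin (angle2 s1 s2) /\ 0 < sin (angle3 s1 s2).
Proof.
  intros H; destruct (angle_range _ _ H) as (A1 & A2 & A3).
  repeat split; apply sin_gt_0; tauto.
Qed.

(** * Closed forms for the partial derivatives of [sigma_hat] *)

Definition sigma_hat_d1 (s1 s2 : R) : R :=
  (ln (2 * sin (angle2 s1 s2)) - ln (2 * sin (angle1 s1 s2))) / 2.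

(* Qualified because [Reals] also exports a [sigma]. *)
Definition sigma_hat_d2 (s1 s2 : R) : R :=
  (Defs.sigma (rho1 s1 s2) (rho2 s1 s2)
   - rho1 s1 s2 * (ln (2 * sin (angle1 s1 s2)) - ln (2 * sin (angle3 s1 s2)))
   - rho2 s1 s2 * (ln (2 * sin (angle2 s1 s2)) - ln (2 * sin (angle3 s1 s2)))) / 2.

Definition cot (x : R) : R := cos x / sin x.

Definition sigma_hat_d11 (s1 s2 : R) : R :=
  PI * (cot (angle1 s1 s2) + cot (angle2 s1 s2)) / (2 * (2 + s2)).

Definition sigma_hat_d12 (s1 s2 : R) : R :=
  (angle1 s1 s2 * cot (angle1 s1 s2) - angle2 s1 s2 * cot (angle2 s1 s2))
  / (2 * (2 + s2)).

Definition sigma_hat_d22 (s1 s2 : R) : R :=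
  (rho1 s1 s2 * angle1 s1 s2 * cot (angle1 s1 s2)
   + rho2 s1 s2 * angle2 s1 s2 * cot (angle2 s1 s2)
   + (rho1 s1 s2 + rho2 s1 s2) * (angle1 s1 s2 + angle2 s1 s2) * cot (angle3 s1 s2))
  / (2 * (2 + s2)).

Ltac expand_angles :=
  unfold sigma_hat, sigma_hat_d1, sigma_hat_d2, sigma_hat_d11, sigma_hat_d12,
    sigma_hat_d22, cot, Defs.sigma, angle1, angle2, angle3, rho1, rho2 in *.

(** [auto_derive] leaves [Derive Lambda] at the three angles, which [D1], [D2], [D3] evaluate; these
    are unfolded together with the goal so that the arguments of [Lambda] match. *)
Ltac derive_in_angles H :=
  let A1 := fresh "A1" in let A2 := fresh "A2" in let A3 := fresh "A3" in
  let D1 := fresh "D1" in let D2 := fresh "D2" in let D3 := fresh "D3" in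
  let S1 := fresh "S1" in let S2 := fresh "S2" in let S3 := fresh "S3" in
  destruct (angle_range _ _ H) as (A1 & A2 & A3);
  destruct (sin_angle_pos _ _ H) as (S1 & S2 & S3);
  assert (D1 := is_derive_Lambda _ A1);
  assert (D2 := is_derive_Lambda _ A2);
  assert (D3 := is_derive_Lambda _ A3);
  clear A1 A2 A3; destruct H; assert (PI <> 0) by apply PI_neq0;
  expand_angles; unfold Rdiv, Rminus in *;
  auto_derive;
  [ repeat split; trivial; try lra; eexists; eassumption
  | repeat match goal with
    | D : is_derive Lambda ?x _ |- context [Derive _ ?x] =>
        replace (Derive (fun y => Lambda y) x) with (Derive Lambda x) by reflexivity;
        rewrite (is_derive_unique _ _ _ D)
    end;
    field; repeat split; try lra ].

(** The third angle does not depend on [s1], and [1 + s2 / 2] times the slope [1 / (2 + s2)] of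
    [rho2] is [1 / 2]. *)
Lemma is_derive_sigma_hat_1 (s1 s2 : R) :
  in_strip s1 s2 -> is_derive (fun u => sigma_hat u s2) s1 (sigma_hat_d1 s1 s2).
Proof. intros H; derive_in_angles H. Qed.

(** The prefactor contributes [sigma / 2]; the logarithms come from the slopes [- rho1 / (2 + s2)]
    and [- rho2 / (2 + s2)]. *)
Lemma is_derive_sigma_hat_2 (s1 s2 : R) :
  in_strip s1 s2 -> is_derive (fun v => sigma_hat s1 v) s2 (sigma_hat_d2 s1 s2).
Proof. intros H; derive_in_angles H. Qed.

Lemma is_derive_sigma_hat_11 (s1 s2 : R) :
  in_strip s1 s2 -> is_derive (fun u => sigma_hat_d1 u s2) s1 (sigma_hat_d11 s1 s2).
Proof. intros H; derive_in_angles H. Qed.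

Lemma is_derive_sigma_hat_12 (s1 s2 : R) :
  in_strip s1 s2 -> is_derive (fun v => sigma_hat_d1 s1 v) s2 (sigma_hat_d12 s1 s2).
Proof. intros H; derive_in_angles H. Qed.

(** The derivative of [sigma] cancels against those of the coefficients [rho1] and [rho2], so only
    cotangents survive; the same happens in the [s2] direction. *)
Lemma is_derive_sigma_hat_21 (s1 s2 : R) :
  in_strip s1 s2 -> is_derive (fun u => sigma_hat_d2 u s2) s1 (sigma_hat_d12 s1 s2).
Proof. intros H; derive_in_angles H. Qed.

Lemma is_derive_sigma_hat_22 (s1 s2 : R) :
  in_strip s1 s2 -> is_derive (fun v => sigma_hat_d2 s1 v) s2 (sigma_hat_d22 s1 s2).
Proof. intros H; derive_in_angles H. Qed.

(** * The derivatives of [G] through [V] and cotangents *)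

Definition V_hat (s1 s2 : R) : R := V (rho1 s1 s2) (rho2 s1 s2).

Lemma V_cot (s1 s2 : R) :
  in_strip s1 s2 ->
  PI * V_hat s1 s2 * (cot (angle1 s1 s2) + cot (angle2 s1 s2)) = 1.
Proof.
  intros H; destruct (sin_angle_pos _ _ H) as (S1 & S2 & S3).
  assert (P := PI_neq0).
  assert (E : sin (angle3 s1 s2) = sin (angle1 s1 s2 + angle2 s1 s2)).
  { rewrite <- sin_PI_x; f_equal; unfold angle1, angle2, angle3; ring. }
  rewrite sin_plus in E.
  change (V_hat s1 s2) with
    (/ PI * (sin (angle1 s1 s2) * sin (angle2 s1 s2) / sin (angle3 s1 s2))).
  rewrite E in *; unfold cot; field; lra.
Qed.

(** Since [rho1 + rho2 = 2 / (2 + s2)], the prefactor turns the coefficient of [V] into 1. *)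
Lemma G_V (s1 s2 : R) : 0 < s2 -> G s1 s2 = (1 - s1 ^ 2) / (2 * (2 + s2)) - V_hat s1 s2.
Proof.
  intros H.
  change (G s1 s2) with
    ((1 + s2 / 2) *
     (rho1 s1 s2 * rho2 s1 s2 - (rho1 s1 s2 + rho2 s1 s2) * V_hat s1 s2)).
  generalize (V_hat s1 s2); intros W; unfold rho1, rho2; field; lra.
Qed.

(** This is logarithmic differentiation of [V], whose denominator is constant in [s1]. *)
Lemma is_derive_G_1 (s1 s2 : R) :
  in_strip s1 s2 ->
  is_derive (fun u => G u s2) s1
    (- s1 / (2 + s2)
     - V_hat s1 s2 * (PI / (2 + s2)) * (cot (angle2 s1 s2) - cot (angle1 s1 s2))).
Proof.
  intros H.
  apply (is_derive_ext (fun u => (1 - u ^ 2) / (2 * (2 + s2)) - V_hat u s2)).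
  - intros u; symmetry; apply G_V, H.
  - unfold V_hat, V in *; derive_in_angles H.
Qed.

Lemma is_derive_G_2 (s1 s2 : R) :
  in_strip s1 s2 ->
  is_derive (fun v => G s1 v) s2
    (- (1 - s1 ^ 2) / (2 * (2 + s2) ^ 2)
     + V_hat s1 s2 / (2 + s2) *
       (angle1 s1 s2 * cot (angle1 s1 s2) + angle2 s1 s2 * cot (angle2 s1 s2)
        + (angle1 s1 s2 + angle2 s1 s2) * cot (angle3 s1 s2))).
Proof.
  intros H.
  apply (is_derive_ext_loc (fun v => (1 - s1 ^ 2) / (2 * (2 + v)) - V_hat s1 v)).
  - apply (locally_interval _ s2 0 p_infty); [apply H|easy|].
    intros v Hv _; symmetry; now apply G_V.
  - unfold V_hat, V in *; derive_in_angles H.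
Qed.

(** * The two ratios of second derivatives *)

Lemma sigma_hat_d11_V (s1 s2 : R) :
  in_strip s1 s2 -> sigma_hat_d11 s1 s2 * (2 * (2 + s2) * V_hat s1 s2) = 1.
Proof.
  intros H; rewrite <- (V_cot _ _ H); destruct H; unfold sigma_hat_d11; field; lra.
Qed.

Lemma sigma_hat_d11_neq0 (s1 s2 : R) : in_strip s1 s2 -> sigma_hat_d11 s1 s2 <> 0.
Proof. intros H E; generalize (sigma_hat_d11_V _ _ H); rewrite E; lra. Qed.

Lemma div_sigma_hat_d11 (s1 s2 x : R) :
  in_strip s1 s2 -> x / sigma_hat_d11 s1 s2 = 2 * (2 + s2) * V_hat s1 s2 * x.
Proof.
  intros H; assert (N := sigma_hat_d11_neq0 _ _ H).
  rewrite <- (Rmult_1_r x) at 1; rewrite <- (sigma_hat_d11_V _ _ H); now field.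
Qed.

Lemma G_1_ratio (s1 s2 : R) :
  in_strip s1 s2 ->
  is_derive (fun u => G u s2) s1 (sigma_hat_d12 s1 s2 / sigma_hat_d11 s1 s2).
Proof.
  intros H; assert (D := is_derive_G_1 _ _ H); assert (C := V_cot _ _ H).
  assert (M : 2 + s2 <> 0) by (destruct H; lra).
  (* The rational term is multiplied by [1 = PI * V * (cot a + cot b)]. Both sides are then linear
     in the cotangents, and [V] and the cotangents can be treated as free variables. *)
  replace (- s1 / (2 + s2)) with
    (- s1 / (2 + s2) * (PI * V_hat s1 s2 * (cot (angle1 s1 s2) + cot (angle2 s1 s2))))
    in D by (rewrite C; ring).
  rewrite div_sigma_hat_d11 by easy; unfold sigma_hat_d12.
  revert D; generalize (V_hat s1 s2) (cot (angle1 s1 s2)) (cot (angle2 s1 s2)).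
  intros W c1 c2 D; evar_last; [exact D|].
  unfold angle1, angle2, rho1, rho2; now field.
Qed.

Lemma G_2_ratio (s1 s2 : R) :
  in_strip s1 s2 ->
  is_derive (fun v => G s1 v) s2 (1 / 2 * (sigma_hat_d22 s1 s2 / sigma_hat_d11 s1 s2)).
Proof.
  intros H; assert (D := is_derive_G_2 _ _ H); assert (C := V_cot _ _ H).
  assert (M : 2 + s2 <> 0) by (destruct H; lra).
  (* The same multiplication by 1; the terms in [cot c] already agree. *)
  replace (- (1 - s1 ^ 2) / (2 * (2 + s2) ^ 2)) with
    (- (1 - s1 ^ 2) / (2 * (2 + s2) ^ 2) *
     (PI * V_hat s1 s2 * (cot (angle1 s1 s2) + cot (angle2 s1 s2))))
    in D by (rewrite C; ring).
  rewrite div_sigma_hat_d11 by easy; unfold sigma_hat_d22.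
  revert D; generalize (V_hat s1 s2) (cot (angle1 s1 s2)) (cot (angle2 s1 s2))
    (cot (angle3 s1 s2)).
  intros W c1 c2 c3 D; evar_last; [exact D|].
  unfold angle1, angle2, rho1, rho2; now field.
Qed.

(** * From the closed forms to iterated partial derivatives *)

Lemma locally_in_strip_1 (s1 s2 : R) :
  in_strip s1 s2 -> locally s1 (fun u => in_strip u s2).
Proof.
  intros [H1 H2]; apply (locally_interval _ s1 (-1) 1); [apply H1|apply H1|].
  now intros u Hu1 Hu2.
Qed.

Lemma locally_in_strip_2 (s1 s2 : R) :
  in_strip s1 s2 -> locally s2 (fun v => in_strip s1 v).
Proof.
  intros [H1 H2]; apply (locally_interval _ s2 0 p_infty); [apply H2|easy|].
  now intros v Hv _.
Qed.

Lemma partial_derive_sigma_hat_1 (s1 s2 : R) :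
  in_strip s1 s2 -> partial_derive 1 0 sigma_hat s1 s2 = sigma_hat_d1 s1 s2.
Proof. intros H; apply is_derive_unique; now apply is_derive_sigma_hat_1. Qed.

Lemma partial_derive_sigma_hat_2 (s1 s2 : R) :
  in_strip s1 s2 -> partial_derive 0 1 sigma_hat s1 s2 = sigma_hat_d2 s1 s2.
Proof. intros H; apply is_derive_unique; now apply is_derive_sigma_hat_2. Qed.

(** Differentiating again requires the closed form of the first partial on a whole neighbourhood,
    which openness of the strip provides. *)
Lemma is_derive_partial_11 (s1 s2 : R) :
  in_strip s1 s2 ->
  is_derive (fun u => partial_derive 1 0 sigma_hat u s2) s1 (sigma_hat_d11 s1 s2).
Proof.
  intros H; apply (is_derive_ext_loc (fun u => sigma_hat_d1 u s2));
    [|now apply is_derive_sigma_hat_11].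
  generalize (locally_in_strip_1 _ _ H); apply filter_imp.
  intros u Hu; symmetry; now apply partial_derive_sigma_hat_1.
Qed.

Lemma is_derive_partial_12 (s1 s2 : R) :
  in_strip s1 s2 ->
  is_derive (fun v => partial_derive 1 0 sigma_hat s1 v) s2 (sigma_hat_d12 s1 s2).
Proof.
  intros H; apply (is_derive_ext_loc (fun v => sigma_hat_d1 s1 v));
    [|now apply is_derive_sigma_hat_12].
  generalize (locally_in_strip_2 _ _ H); apply filter_imp.
  intros v Hv; symmetry; now apply partial_derive_sigma_hat_1.
Qed.

Lemma is_derive_partial_21 (s1 s2 : R) :
  in_strip s1 s2 ->
  is_derive (fun u => partial_derive 0 1 sigma_hat u s2) s1 (sigma_hat_d12 s1 s2).
Proof.
  intros H; apply (is_derive_ext_loc (fun u => sigma_hat_d2 u s2));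
    [|now apply is_derive_sigma_hat_21].
  generalize (locally_in_strip_1 _ _ H); apply filter_imp.
  intros u Hu; symmetry; now apply partial_derive_sigma_hat_2.
Qed.

Lemma is_derive_partial_22 (s1 s2 : R) :
  in_strip s1 s2 ->
  is_derive (fun v => partial_derive 0 1 sigma_hat s1 v) s2 (sigma_hat_d22 s1 s2).
Proof.
  intros H; apply (is_derive_ext_loc (fun v => sigma_hat_d2 s1 v));
    [|now apply is_derive_sigma_hat_22].
  generalize (locally_in_strip_2 _ _ H); apply filter_imp.
  intros v Hv; symmetry; now apply partial_derive_sigma_hat_2.
Qed.

(* [partial_derive m k f x y] is the derivative of [f] at [(x, y)] taken [k]
   times in the second variable, then [m] times in the first. *)
Theorem mainTheorem5 :
  forall s1 s2 : R, -1 < s1 < 1 -> 0 < s2 ->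
    has_second_partials sigma_hat s1 s2 /\
    partial_derive 2 0 sigma_hat s1 s2 <> 0 /\
    is_derive (fun u => G u s2) s1
      (partial_derive 1 1 sigma_hat s1 s2 / partial_derive 2 0 sigma_hat s1 s2) /\
    is_derive (fun v => G s1 v) s2
      (1 / 2 * (partial_derive 0 2 sigma_hat s1 s2 / partial_derive 2 0 sigma_hat s1 s2)).
Proof.
  intros s1 s2 H1 H2; assert (H : in_strip s1 s2) by easy.
  assert (D11 := is_derive_partial_11 _ _ H).
  assert (D12 := is_derive_partial_12 _ _ H).
  assert (D21 := is_derive_partial_21 _ _ H).
  assert (D22 := is_derive_partial_22 _ _ H).
  replace (partial_derive 2 0 sigma_hat s1 s2) with (sigma_hat_d11 s1 s2)
    by (symmetry; exact (is_derive_unique _ _ _ D11)).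
  (* Here the [s2] derivative is taken first, hence [D21]. *)
  replace (partial_derive 1 1 sigma_hat s1 s2) with (sigma_hat_d12 s1 s2)
    by (symmetry; exact (is_derive_unique _ _ _ D21)).
  replace (partial_derive 0 2 sigma_hat s1 s2) with (sigma_hat_d22 s1 s2)
    by (symmetry; exact (is_derive_unique _ _ _ D22)).
  split; [|split; [|split]].
  - repeat split; eexists; try eassumption.
    + now apply is_derive_sigma_hat_1.
    + now apply is_derive_sigma_hat_2.
  - now apply sigma_hat_d11_neq0.
  - now apply G_1_ratio.
  - now apply G_2_ratio.
Qed.
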